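(* Let $\beta\in\mathbb{R}\setminus\{0\}$ and $\sigma>0$. Then $$A_\sigma\left(f_{0,\beta}\right)_\infty=A_\sigma\left(f_{0,\beta,c}\right)_\infty=A_\sigma\left(f_{0,\beta,s}\right)_\infty=1,$$ and the entire functions of exponential type $\sigma$ of best approximation to $f_{0,\beta}$, $f_{0,\beta,c}$, and $f_{0,\beta,s}$ in the metric of $L_\infty(\mathbb{R})$ coincide with zero; that is, if $f$ is any one of these three functions, then $g\in B_\sigma$ satisfies $\|f-g\|_{L_\infty(\mathbb{R})}=A_\sigma(f)_\infty$ if and only if $g\equiv 0$.
   Context: For $x\in\mathbb{R}\setminus\{0\}$ (the value at $x=0$ is irrelevant), $f_{0,\beta}(x):=|x|^{i\beta}=f_{0,\beta,c}(x)+i f_{0,\beta,s}(x)$, where $f_{0,\beta,c}(x):=\cos(\beta\log|x|)$ and $f_{0,\beta,s}(x):=\sin(\beta\log|x|)$. For $\sigma\ge 0$, $B_\sigma$ is the set of all complex-valued entire functions of exponential type (at most) $\sigma$, i.e. entire $g$ such that for every $\varepsilon>0$ there is a constant $C_\varepsilon$ with $|g(z)|\le C_\varepsilon e^{(\sigma+\varepsilon)|z|}$ for all $z\in\mathbb{C}$. $\|f\|_{L_\infty(\mathbb{R})}=\operatorname{ess\,sup}_{x\in\mathbb{R}}|f(x)|$, and $A_\sigma(f)_\infty:=\inf_{g\in B_\sigma}\|f-g\|_{L_\infty(\mathbb{R})}$. *)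

(* Defs.v *)
From HB Require Import structures.
From mathcomp Require Import all_boot all_order all_algebra.
From mathcomp Require Import complex.
From mathcomp Require Import all_classical all_reals all_analysis.
From mathcomp Require Import ess_sup_inf.

Set Implicit Arguments.
Unset Strict Implicit.
Unset Printing Implicit Defensive.

Import Order.TTheory GRing.Theory Num.Theory.
Import numFieldNormedType.Exports.

Local Open Scope ring_scope.
Local Open Scope classical_set_scope.
Local Open Scope complex_scope.

(* The norm `|z| of R[i] is itself an element of R[i]; normc is the real-valued
   modulus. *)
Notation normc := ComplexField.Normc.normc.

(* R[i]^o is R[i] seen as a normed module over itself: the difference quotients
   in derivable have complex increments. *)
Definition entire (R : realType) (g : R[i] -> R[i]) : Prop :=
  forall z : R[i], derivable (g : R[i]^o -> R[i]^o) z 1.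

Definition exp_type (R : realType) (sigma : R) : set (R[i] -> R[i]) :=
  [set g | entire g /\
    forall eps : R, 0 < eps -> exists C : R,
      forall z : R[i], normc (g z) <= C * expR ((sigma + eps) * normc z)].

Definition Linfty_norm (R : realType) (h : R -> R[i]) : \bar R :=
  ess_sup (@lebesgue_measure R) (fun x : R => (normc (h x))%:E).

Definition approx_error (R : realType) (f : R -> R[i]) (g : R[i] -> R[i]) :
    \bar R :=
  Linfty_norm (fun x : R => f x - g x%:C).

Definition best_error (R : realType) (sigma : R) (f : R -> R[i]) : \bar R :=
  ereal_inf [set approx_error f g | g in exp_type sigma].

Definition cexp (R : realType) (z : R[i]) : R[i] :=
  (expR (complex.Re z))%:C * (cos (complex.Im z) +i* sin (complex.Im z)).

(* x to the complex power w, meant for x > 0 *)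
Definition cpower (R : realType) (x : R) (w : R[i]) : R[i] :=
  cexp (w * (ln x)%:C).

(* As ln 0 = 0, the functions below take the values 1, 1 and 0 at x = 0. *)
Definition f0 (R : realType) (beta : R) (x : R) : R[i] :=
  cpower `|x| ('i * beta%:C).

Definition f0c (R : realType) (beta : R) (x : R) : R := cos (beta * ln `|x|).

Definition f0s (R : realType) (beta : R) (x : R) : R := sin (beta * ln `|x|).

Lemma f0E (R : realType) (beta x : R) :
  f0 beta x = (f0c beta x)%:C + 'i * (f0s beta x)%:C.
Proof.
rewrite /f0 /cpower /cexp /f0c /f0s; simpc.
by rewrite expR0 !mul1r.
Qed.

(* Main.v *)
Require Import Defs.
From HB Require Import structures.
From mathcomp Require Import all_boot all_order all_algebra.
From mathcomp Require Import complex.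
From mathcomp Require Import all_classical all_reals all_analysis.
From mathcomp Require Import ess_sup_inf.
From mathcomp Require Import ring lra.

Set Implicit Arguments.
Unset Strict Implicit.
Unset Printing Implicit Defensive.

Import Order.TTheory GRing.Theory Num.Theory.
Import numFieldNormedType.Exports.

Local Open Scope ring_scope.
Local Open Scope classical_set_scope.
Local Open Scope complex_scope.

(** The theorem is local at the origin. Each of the three functions [f] has
    modulus at most [1] and takes the values [1] and [-1] at points arbitrarily
    close to [0]. Let [g] be entire with [|f - g| <= 1] almost everywhere, hence
    everywhere off [0], by continuity. Where [f = 1] this says
    [|g|^2 <= 2 Re g], and where [f = -1] it says [|g|^2 <= - 2 Re g]. So [Re g]
    takes both signs arbitrarily close to [0] on the real axis; being the
    restriction of an entire function, it vanishes identically there. Then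
    [g = 0] at every point where [f = 1], and these points accumulate at [0],
    so [g = 0] ([entire_within_one_eq0]). Hence no entire function has error
    below that of [0], which is [1], and no other one attains it
    ([best_approximation_eq0]).

    What carries the argument is the identity theorem for functions that are
    only assumed complex differentiable at each point. Goursat's theorem
    ([goursat]) is proved on rectangles by bisection. It is applied in the
    coordinate [w] with [zeta = cexp w], where circles about the origin become
    vertical segments of length [2 * pi]: the integral of a [2i * pi]-periodic
    holomorphic function over such a segment does not depend on its abscissa
    ([period_int_const]). This stays true if holomorphy fails on one vertical
    line across which the function is continuous
    ([period_int_const_off_line]), so it applies to the difference quotient
    [(g zeta - g z) / (zeta - z)] times [zeta], whose integral tends to [0] with
    the radius. The vanishing of this integral is Cauchy's formula
    ([cauchy_diffq]). Expanding [zeta / (zeta - z)] as a finite geometric sum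
    gives Taylor polynomials of every order with a remainder of geometric size
    ([taylor_remainder]), and the identity theorem follows: zeros accumulating
    at [0] kill the coefficients one after the other, and letting the order
    tend to infinity kills the remainder. *)

(** * Complex modulus, topology and derivative *)

(* Keeps [/=] from turning moduli into square roots. *)
Local Arguments ComplexField.Normc.normc : simpl never.

Section complex_basics.
Variable R : realType.
Local Notation C := (R[i]^o).

Lemma normcE (z : R[i]) : `|z| = (normc z)%:C.
Proof. by []. Qed.

Lemma normc_ge0 (z : R[i]) : 0 <= normc z.
Proof. by rewrite -lecR -normcE normr_ge0. Qed.

Lemma normc_eq0 (z : R[i]) : (normc z == 0) = (z == 0).
Proof. by rewrite -(normr_eq0 z) normcE eq_complex /= eqxx andbT. Qed.

Lemma normc_gt0 (z : R[i]) : (0 < normc z) = (z != 0).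
Proof. by rewrite lt_neqAle eq_sym normc_eq0 normc_ge0 andbT. Qed.

Lemma normcM (z w : R[i]) : normc (z * w) = normc z * normc w.
Proof. exact: ComplexField.Normc.normcM. Qed.

Lemma normcX (z : R[i]) n : normc (z ^+ n) = normc z ^+ n.
Proof.
elim: n => [|n IH]; first by rewrite !expr0 ComplexField.Normc.normc1.
by rewrite !exprS normcM IH.
Qed.

Lemma normcV (z : R[i]) : normc z^-1 = (normc z)^-1.
Proof. exact: ComplexField.Normc.normcV. Qed.

Lemma normc_real (x : R) : normc x%:C = `|x|.
Proof. by rewrite /ComplexField.Normc.normc /= expr0n addr0 sqrtr_sqr. Qed.

Lemma normc_Re (z : R[i]) : `|complex.Re z| <= normc z.
Proof. by rewrite -lecR; exact: normc_ge_Re. Qed.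

Lemma normc_Im (z : R[i]) : `|complex.Im z| <= normc z.
Proof.
case: z => a b; rewrite /ComplexField.Normc.normc /= -(sqrtr_sqr b).
by rewrite ler_wsqrtr // lerDr sqr_ge0.
Qed.

Lemma normc_le (z : R[i]) : normc z <= `|complex.Re z| + `|complex.Im z|.
Proof.
rewrite {1}(complexE z); apply: le_trans (le_normcD _ _) _.
rewrite normcM !normc_real [normc 'i]/ComplexField.Normc.normc /=.
by rewrite expr0n expr1n add0r sqrtr1 mul1r.
Qed.

Lemma normc_distC (z w : R[i]) : normc (z - w) = normc (w - z).
Proof. by rewrite -normcN opprB. Qed.

Lemma nbhsCP (p : C) (A : set C) :
  nbhs p A <-> exists2 d : R, 0 < d & forall w : R[i], normc (w - p) < d -> A w.
Proof.
split=> [/nbhs_ballP[e /= e0 eA]|[d d0 dA]].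
  have eE : e = (complex.Re e)%:C by rewrite RRe_real // gtr0_real.
  rewrite eE ltcR in e0.
  exists (complex.Re e) => // w wp; apply: eA.
  by rewrite -ball_normE /= normcE normc_distC eE ltcR.
apply/nbhs_ballP; exists d%:C => /=; first by rewrite ltcR.
by move=> w; rewrite -ball_normE /= normcE normc_distC ltcR => /dA.
Qed.

Lemma cvgCP (T : Type) (F : set_system T) (FF : Filter F) (f : T -> R[i])
    (l : R[i]) :
  (f : T -> C) @ F --> (l : C) <->
  forall e : R, 0 < e -> \forall t \near F, normc (f t - l) < e.
Proof.
split=> [/cvgrPdist_lt fl e e0|fl].
  have /fl : 0 < e%:C by rewrite ltcR.
  by apply: filterS => t; rewrite normcE normc_distC ltcR.
apply/cvgrPdist_lt => e e0.
have eE : e = (complex.Re e)%:C by rewrite RRe_real // gtr0_real.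
rewrite eE ltcR in e0.
apply: filterS (fl _ e0) => t.
by rewrite normcE normc_distC [in X in _ -> X]eE ltcR.
Qed.

Lemma continuousCP (f : R[i] -> R[i]) (p : R[i]) :
  {for (p : C), continuous (f : C -> C)} <->
  forall e : R, 0 < e -> exists2 d : R, 0 < d &
    forall w, normc (w - p) < d -> normc (f w - f p) < e.
Proof.
split=> [cf e e0|H].
  by have /cvgCP /(_ _ e0) /nbhsCP := cf.
by apply/(@cvgCP C (nbhs (p : C)) _) => e /H /nbhsCP.
Qed.

Lemma continuous_cM (T : topologicalType) (f g : T -> R[i]) :
  continuous (f : T -> C) -> continuous (g : T -> C) ->
  continuous ((fun t => f t * g t) : T -> C).
Proof.
move=> cf cg t; have D := @cvgM R[i] _ _ _ _ _ _ _ (cf t) (cg t).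
exact: D.
Qed.

Lemma continuous_cB (T : topologicalType) (f g : T -> R[i]) :
  continuous (f : T -> C) -> continuous (g : T -> C) ->
  continuous ((fun t => f t - g t) : T -> C).
Proof.
move=> cf cg t; have D := @cvgB _ C _ _ _ _ _ _ _ (cf t) (cg t).
exact: D.
Qed.

Lemma continuous_ccst (T : topologicalType) (c : R[i]) :
  continuous ((fun=> c) : T -> C).
Proof. by move=> t; exact: cvg_cst. Qed.

Lemma continuous_real_complex : continuous (real_complex R : R -> C).
Proof.
move=> x; apply/cvgCP => e e0; apply: filterS (nbhsx_ballx x e e0) => t.
by rewrite -ball_normE /= -rmorphB normc_real distrC.
Qed.

Lemma continuous_Re : continuous (@complex.Re R : C -> R).
Proof.
move=> p; apply/(@cvgrPdist_lt _ _ _ _ (nbhs_filter (p : C))) => e e0.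
apply/nbhsCP; exists e => // w wp.
rewrite distrC; apply: le_lt_trans wp.
by rewrite -raddfB; exact: normc_Re.
Qed.

Lemma continuous_Im : continuous (@complex.Im R : C -> R).
Proof.
move=> p; apply/(@cvgrPdist_lt _ _ _ _ (nbhs_filter (p : C))) => e e0.
apply/nbhsCP; exists e => // w wp.
rewrite distrC; apply: le_lt_trans wp.
by rewrite -raddfB; exact: normc_Im.
Qed.

Lemma continuous_normc : continuous (@normc R : C -> R).
Proof.
move=> p; apply/(@cvgrPdist_lt _ _ _ _ (nbhs_filter (p : C))) => e e0.
apply/nbhsCP; exists e => // w wp.
rewrite distrC; apply: le_lt_trans wp.
rewrite ler_norml lerBlDr lerNl opprB lerBlDr; apply/andP; split.
  by rewrite normc_distC -{1}(subrK w p); exact: le_normcD.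
by rewrite -{1}(subrK p w); exact: le_normcD.
Qed.

(** With the increment on the right-hand side instead of in a denominator, this
    form of derivability is the one that the estimate of the integral along a
    small rectangle uses. *)
Definition cderiv (f : R[i] -> R[i]) (p d : R[i]) : Prop :=
  forall e : R, 0 < e -> exists2 dlt : R, 0 < dlt & forall w,
    normc (w - p) < dlt -> normc (f w - f p - d * (w - p)) <= e * normc (w - p).

Lemma derivable_cderiv (f : C -> C) (p : C) :
  derivable f p 1 -> exists d, cderiv f p d.
Proof.
move=> /cvg_ex[d]; move/cvgCP => /= fd; exists d => e e0.
have /fd /nbhsCP[dlt dlt0 H] := e0.
exists dlt => // w wp; have [->|wnp] := eqVneq w p.
  by rewrite !subrr mulr0 subr0 ComplexField.Normc.normc0 mulr0.
have := H (w - p); rewrite subr0 subr_eq0 => /(_ wp wnp) /ltW.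
have w0 : w - p != 0 by rewrite subr_eq0.
rewrite -(ler_pM2r (x := normc (w - p))) ?normc_gt0 // -normcM.
suff -> : ((w - p)^-1 *: (f ((w - p) *: 1 + p) - f p) - d) * (w - p) =
  f w - f p - d * (w - p) by [].
rewrite /GRing.scale /= mulr1 subrK mulrBl mulrC mulrA divff // mul1r.
by [].
Qed.

Lemma cderiv_derivable (f : C -> C) (p : C) d : cderiv f p d -> derivable f p 1.
Proof.
move=> fd; apply/cvg_ex; exists d; apply/cvgCP => e e0.
have e20 : 0 < e / 2 by rewrite divr_gt0.
have [dlt dlt0 H] := fd _ e20.
apply/nbhsCP; exists dlt => // h; rewrite subr0 => hd h0 /=.
have := H (h + p); rewrite addrK => /(_ hd) H1.
rewrite -(ltr_pM2r (x := normc h)) ?normc_gt0 // -normcM.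
rewrite /GRing.scale /= mulr1 mulrBl mulrC mulrA divff // mul1r.
apply: le_lt_trans H1 _; rewrite ltr_pM2r ?normc_gt0 //.
by rewrite ltr_pdivrMr // mulr_natr mulr2n ltrDl.
Qed.

End complex_basics.

(** * The complex exponential *)

Section complex_exponential.
Variable R : realType.
Local Notation C := (R[i]^o).

Lemma is_derive0_le (f : R -> R) (df : R) : is_derive (0 : R) (1 : R) f df ->
  forall e : R, 0 < e -> exists2 dlt : R, 0 < dlt & forall h,
    `|h| < dlt -> `|f h - f 0 - df * h| <= e * `|h|.
Proof.
move=> -[fd dfE] e e0.
have /cvgrPdist_lt /(_ _ e0) :
    h^-1 *: ((f \o shift 0) (h *: 1) - f 0) @[h --> 0^'] --> df.
  by rewrite -dfE; exact: fd.
move=> /nbhs_ballP[d /= d0 dH].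
exists d => // h hd; have [->|h0] := eqVneq h 0.
  by rewrite subrr mulr0 subr0 normr0 mulr0.
have := dH h; rewrite -ball_normE /= sub0r normrN => /(_ hd h0) /ltW.
rewrite -(ler_pM2r (x := `|h|)) ?normr_gt0 // -normrM.
suff -> : (df - h^-1 *: (f (h *: 1 + 0) - f 0)) * h = - (f h - f 0 - df * h).
  by rewrite normrN.
by rewrite /GRing.scale /= mulr1 addr0; field.
Qed.

Lemma cexpD (z w : R[i]) : cexp (z + w) = cexp z * cexp w.
Proof.
case: z => a b; case: w => c d; rewrite /cexp /= expRD cosD sinD.
by apply/eqP; rewrite eq_complex /=; apply/andP; split; apply/eqP; ring.
Qed.

Lemma normc_cexp (z : R[i]) : normc (cexp z) = expR (complex.Re z).
Proof.
rewrite /cexp normcM normc_real ger0_norm ?expR_ge0 //.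
by rewrite [normc (_ +i* _)]/ComplexField.Normc.normc /= cos2Dsin2 sqrtr1 mulr1.
Qed.

Lemma cexp_neq0 (z : R[i]) : cexp z != 0.
Proof. by rewrite -normc_gt0 normc_cexp expR_gt0. Qed.

Lemma cexp_periodic (a b : R) : cexp (a +i* (b + pi *+ 2)) = cexp (a +i* b).
Proof.
by rewrite /cexp /= cosD2pi sinD2pi.
Qed.

Lemma cderiv_cexp (p : R[i]) : cderiv (@cexp R) p (cexp p).
Proof.
move=> e e0.
(* The constant 6 collects the six real error terms below. *)
pose E := normc (cexp p); have E0 : 0 < E by rewrite normc_gt0 cexp_neq0.
pose e' := e / (6 * E).
have e'0 : 0 < e' by rewrite divr_gt0 // mulr_gt0.
have [d1 d10 H1] := is_derive0_le (is_derive_expR (0 : R)) e'0.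
have [d2 d20 H2] := is_derive0_le (is_derive_cos (0 : R)) e'0.
have [d3 d30 H3] := is_derive0_le (is_derive_sin (0 : R)) e'0.
have [d4 d40 H4] : exists2 d : R, 0 < d &
    forall x, `|x| < d -> `|expR x - 1| < Num.min e' 1.
  have m0 : 0 < Num.min e' 1 by rewrite lt_min e'0 ltr01.
  have /cvgrPdist_lt /(_ _ m0) /nbhs_ballP[d /= d0 dH] := @continuous_expR R 0.
  exists d => // x xd; have := dH x.
  by rewrite -ball_normE /= sub0r normrN expR0 distrC; exact.
exists (Num.min (Num.min d1 d2) (Num.min d3 d4)) => [|w].
  by rewrite !lt_min d10 d20 d30 d40.
set h := w - p.
have -> : w = p + h by rewrite /h addrC subrK.
rewrite cexpD !lt_min => /andP[/andP[h1 h2] /andP[h3 h4]].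
have -> : cexp p * cexp h - cexp p - cexp p * h = cexp p * (cexp h - 1 - h).
  by ring.
rewrite normcM -/E.
have -> : e * normc h = E * (6 * e' * normc h).
  by rewrite /e'; field; rewrite gt_eqF.
rewrite ler_pM2l //.
have := normc_Re h; have := normc_Im h.
case: h h1 h2 h3 h4 => x y h1 h2 h3 h4 /= hy hx.
set r := normc _ in h1 h2 h3 h4 hx hy *.
have {H1} H1 := H1 _ (le_lt_trans hx h1).
have {H2} H2 := H2 _ (le_lt_trans hy h2).
have {H3} H3 := H3 _ (le_lt_trans hy h3).
have {H4} := H4 _ (le_lt_trans hx h4); rewrite lt_min => /andP[H4 H5].
rewrite expR0 mul1r in H1; rewrite cos0 sin0 oppr0 mul0r subr0 in H2.
rewrite sin0 cos0 mul1r subr0 in H3.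
apply: le_trans (normc_le _) _; rewrite /cexp /=.
have e2 : `|expR x| <= 2.
  have -> : expR x = (expR x - 1) + 1 by ring.
  by apply: le_trans (ler_normD _ _) _; rewrite normr1; lra.
have A1 : `|expR x * cos y - 0 * sin y - 1 - x| <= 2 * (e' * r) + e' * r.
  have -> : expR x * cos y - 0 * sin y - 1 - x
    = expR x * (cos y - 1) + (expR x - 1 - x) by ring.
  apply: le_trans (ler_normD _ _) _; rewrite normrM lerD //.
    apply: ler_pM => //; apply: le_trans H2 _.
    by rewrite ler_pM2l.
  by apply: le_trans H1 _; rewrite ler_pM2l.
have A2 : `|expR x * sin y + 0 * cos y - 0 - y| <= 2 * (e' * r) + e' * r.
  have -> : expR x * sin y + 0 * cos y - 0 - y
    = expR x * (sin y - y) + (expR x - 1) * y by ring.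
  apply: le_trans (ler_normD _ _) _; rewrite !normrM lerD //.
    apply: ler_pM => //; apply: le_trans H3 _.
    by rewrite ler_pM2l.
  by apply: ler_pM => //; exact: ltW.
rewrite ?oppr0 ?addr0; rewrite ?oppr0 ?addr0 in A1 A2.
by apply: le_trans (lerD A1 A2) _; lra.
Qed.

Lemma derivable_cexp (p : C) : derivable (@cexp R : C -> C) p 1.
Proof. exact: cderiv_derivable (cderiv_cexp p). Qed.

Lemma continuous_cexp : continuous (@cexp R : C -> C).
Proof.
by move=> p; apply/differentiable_continuous/derivable1_diffP/derivable_cexp.
Qed.

End complex_exponential.

(** * Integrals of continuous complex-valued functions *)

Section complex_integral.
Variable R : realType.
Local Notation C := (R[i]^o).
Local Notation mu := (@lebesgue_measure R).

Definition cint (a b : R) (f : R -> R[i]) : R[i] :=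
  (\int[mu]_(t in `[a, b]) complex.Re (f t)) +i*
  (\int[mu]_(t in `[a, b]) complex.Im (f t)).

Lemma integrable_continuous (f : R -> R) (a b : R) : continuous f ->
  mu.-integrable `[a, b] (EFin \o f).
Proof.
move=> cf; apply: continuous_compact_integrable; first exact: segment_compact.
exact: continuous_subspaceT.
Qed.

Lemma integrable_Re (f : R -> R[i]) (a b : R) : continuous (f : R -> C) ->
  mu.-integrable `[a, b] (EFin \o (fun t => complex.Re (f t))).
Proof.
move=> cf; apply: integrable_continuous => t.
by apply: continuous_comp (cf t) _; exact: continuous_Re.
Qed.

Lemma integrable_Im (f : R -> R[i]) (a b : R) : continuous (f : R -> C) ->
  mu.-integrable `[a, b] (EFin \o (fun t => complex.Im (f t))).
Proof.
move=> cf; apply: integrable_continuous => t.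
by apply: continuous_comp (cf t) _; exact: continuous_Im.
Qed.

Lemma eq_cint (a b : R) (f g : R -> R[i]) :
  (forall t, a <= t <= b -> f t = g t) -> cint a b f = cint a b g.
Proof.
by move=> fg; congr Complex; apply: eq_Rintegral => t;
  rewrite inE /= in_itv /= => /fg ->.
Qed.

Lemma cintD (a b : R) (f g : R -> R[i]) :
  continuous (f : R -> C) -> continuous (g : R -> C) ->
  cint a b (fun t => f t + g t) = cint a b f + cint a b g.
Proof.
move=> cf cg; rewrite /cint.
under eq_Rintegral do rewrite raddfD.
under [X in _ +i* X]eq_Rintegral do rewrite raddfD.
rewrite !RintegralD //; [exact: integrable_Im|exact: integrable_Im
  |exact: integrable_Re|exact: integrable_Re].
Qed.

Lemma cintZ (a b : R) (c : R[i]) (f : R -> R[i]) : continuous (f : R -> C) ->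
  cint a b (fun t => c * f t) = c * cint a b f.
Proof.
move=> cf; case: c => x y; rewrite /cint.
have iR := integrable_Re a b cf; have iI := integrable_Im a b cf.
have cR : continuous (fun t => complex.Re (f t)).
  by move=> t; apply: continuous_comp (cf t) _; exact: continuous_Re.
have cI : continuous (fun t => complex.Im (f t)).
  by move=> t; apply: continuous_comp (cf t) _; exact: continuous_Im.
have iZ (z : R) (h : R -> R) : continuous h ->
    mu.-integrable `[a, b] (EFin \o (fun t => z * h t)).
  move=> ch; apply: integrable_continuous => t; apply: continuousM (ch t).
  exact: cvg_cst.
have ReM w : complex.Re ((x +i* y) * w) = x * complex.Re w - y * complex.Im w.
  by case: w.
have ImM w : complex.Im ((x +i* y) * w) = x * complex.Im w + y * complex.Re w.
  by case: w.
under eq_Rintegral do rewrite ReM.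
under [X in _ +i* X]eq_Rintegral do rewrite ImM.
rewrite RintegralB ?RintegralD ?RintegralZl //; do ?by exact: iZ.
Qed.

Lemma cint_cst (a b : R) (c : R[i]) : a <= b ->
  cint a b (fun=> c) = c * (b - a)%:C.
Proof.
move=> ab; rewrite /cint !Rintegral_cst //= lebesgue_measure_itv /= lte_fin.
case: c => x y; case: ltP => [_|ba] /=; simpc => //.
by have -> : a = b by [apply/eqP; rewrite eq_le ab]; rewrite subrr !mulr0.
Qed.

Lemma cintB (a b : R) (f g : R -> R[i]) :
  continuous (f : R -> C) -> continuous (g : R -> C) ->
  cint a b (fun t => f t - g t) = cint a b f - cint a b g.
Proof.
move=> cf cg; have cNg := continuous_cM (@continuous_ccst R _ (-1)) cg.
have E1 := @cintD a b _ _ cf cNg; have E2 := @cintZ a b (-1) _ cg.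
rewrite E2 mulN1r in E1; rewrite -E1.
by apply: eq_cint => t _; rewrite mulN1r.
Qed.

Lemma continuous_csum (T : topologicalType) (n : nat) (f : nat -> T -> R[i]) :
  (forall j, continuous (f j : T -> C)) ->
  continuous ((fun t => \sum_(j < n) f j t) : T -> C).
Proof.
move=> cf; elim: n => [|n IH] t.
  by under eq_fun do rewrite big_ord0; exact: cvg_cst.
by under eq_fun do rewrite big_ord_recr /=; apply: continuousD (IH t) (cf n t).
Qed.

Lemma cint_sum (a b : R) (n : nat) (f : nat -> R -> R[i]) : a <= b ->
  (forall j, continuous (f j : R -> C)) ->
  cint a b (fun t => \sum_(j < n) f j t) = \sum_(j < n) cint a b (f j).
Proof.
move=> ab cf; elim: n => [|n IH].
  under eq_cint do rewrite big_ord0.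
  by rewrite big_ord0 cint_cst // mul0r.
under eq_cint do rewrite big_ord_recr /=.
rewrite cintD //; first by rewrite IH big_ord_recr.
exact: continuous_csum.
Qed.

Lemma cint_cat (a b c : R) (f : R -> R[i]) : continuous (f : R -> C) ->
  a <= b -> b <= c -> cint a c f = cint a b f + cint b c f.
Proof.
move=> cf ab bc.
have S (h : R -> R) : mu.-integrable `[a, c] (EFin \o h) ->
    mu.-integrable `[b, c] (EFin \o h) ->
    \int[mu]_(t in `[a, c]) h t =
    \int[mu]_(t in `[a, b]) h t + \int[mu]_(t in `[b, c]) h t.
  move=> ih ih'.
  have := @Rintegral_itvB _ h (BLeft a) (BRight c) b ih.
  rewrite !bnd_simp => /(_ ab bc) /eqP; rewrite subr_eq addrC => /eqP ->.
  rewrite Rintegral_itv_obnd_cbnd //; apply: integrableS ih' => //.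
  by apply: subset_itv; rewrite bnd_simp.
rewrite /cint; apply/eqP; rewrite eq_complex /=.
by rewrite !S ?eqxx //; do ?[exact: integrable_Re|exact: integrable_Im].
Qed.

(** The factor [2] comes from bounding the real and the imaginary part
    separately. *)
Lemma normc_cint_le (a b M : R) (f : R -> R[i]) : continuous (f : R -> C) ->
  a <= b -> (forall t, a <= t <= b -> normc (f t) <= M) ->
  normc (cint a b f) <= 2 * (M * (b - a)).
Proof.
move=> cf ab fM.
have B (h : R -> R) : mu.-integrable `[a, b] (EFin \o h) ->
    (forall t, a <= t <= b -> `|h t| <= M) ->
    `|\int[mu]_(t in `[a, b]) h t| <= M * (b - a).
  move=> ih hM; apply: le_trans (le_normr_Rintegral _ ih) _ => //.
  have -> : M * (b - a) = \int[mu]_(t in `[a, b]) (cst M t).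
    rewrite Rintegral_cst //= lebesgue_measure_itv /= lte_fin.
    case: ltP => [_|ba] //=.
    by have -> : a = b by [apply/eqP; rewrite eq_le ab]; rewrite subrr !mulr0.
  apply: le_Rintegral => //.
  - exact: (integrable_abse ih).
  - by apply: integrable_continuous => t; exact: cvg_cst.
apply: le_trans (normc_le _) _; rewrite mulr_natl mulr2n.
apply: lerD; apply: B; first exact: integrable_Re.
- by move=> t /fM; apply: le_trans; exact: normc_Re.
- exact: integrable_Im.
- by move=> t /fM; apply: le_trans; exact: normc_Im.
Qed.

End complex_integral.

(** * Goursat's theorem on rectangles *)

Section goursat.
Variable R : realType.
Local Notation C := (R[i]^o).

Lemma continuous_Complex (T : topologicalType) (f g : T -> R) :
  continuous f -> continuous g -> continuous ((fun t => f t +i* g t) : T -> C).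
Proof.
move=> cf cg t.
under eq_fun do rewrite (complexE (_ +i* _)) /=.
apply: (@cvgD _ C).
  by apply: continuous_comp (cf t) _; exact: continuous_real_complex.
apply: (@cvgM R[i]); first exact: cvg_cst.
by apply: continuous_comp (cg t) _; exact: continuous_real_complex.
Qed.

Lemma continuous_hline (H : R[i] -> R[i]) (y : R) : continuous (H : C -> C) ->
  continuous ((fun t => H (t +i* y)) : R -> C).
Proof.
move=> cH t; apply: (@continuous_comp _ C C (fun t => t +i* y) H t _ (cH _)).
by apply: continuous_Complex => u; [exact: cvg_id|exact: cvg_cst].
Qed.

Lemma continuous_vline (H : R[i] -> R[i]) (x : R) : continuous (H : C -> C) ->
  continuous ((fun t => H (x +i* t)) : R -> C).
Proof.
move=> cH t; apply: (@continuous_comp _ C C (fun t => x +i* t) H t _ (cH _)).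
by apply: continuous_Complex => u; [exact: cvg_cst|exact: cvg_id].
Qed.

Lemma nested_bisection (v : nat -> R) (h : R) : 0 <= h ->
  (forall n, exists b : bool, v n.+1 = v n + b%:R * (2^-1 ^+ n.+1 * h)) ->
  exists p, forall n, v n <= p <= v n + 2^-1 ^+ n * h.
Proof.
move=> h0 vS.
have s0 n : 0 <= 2^-1 ^+ n * h by rewrite mulr_ge0 // exprn_ge0.
have sE n : 2^-1 ^+ n * h = 2 * (2^-1 ^+ n.+1 * h) by rewrite exprS; field.
have v1 n : v n <= v n.+1.
  by have [b ->] := vS n; rewrite lerDl mulr_ge0 // ler0n.
have v2 n : v n.+1 + 2^-1 ^+ n.+1 * h <= v n + 2^-1 ^+ n * h.
  have [b ->] := vS n; rewrite -addrA lerD2l (sE n).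
  have := s0 n.+1; case: b => /=; lra.
have mono m n : v n <= v (n + m)%N.
  by elim: m => [|m IH]; rewrite ?addn0 // addnS (le_trans IH).
have anti m n : v (n + m)%N + 2^-1 ^+ (n + m) * h <= v n + 2^-1 ^+ n * h.
  by elim: m => [|m IH]; rewrite ?addn0 // addnS (le_trans (v2 _)).
have vub m n : v m <= v n + 2^-1 ^+ n * h.
  apply: le_trans (anti m n); rewrite addnC.
  by apply: le_trans (mono n m) _; rewrite lerDl.
have hs : has_sup (range v).
  split; first by exists (v 0%N), 0%N.
  by exists (v 0%N + 2^-1 ^+ 0 * h) => _ [m _ <-].
exists (sup (range v)) => n; apply/andP; split.
  by apply: sup_upper_bound => //; exists n.
by apply: ge_sup; [exists (v 0%N), 0%N|move=> _ [m _ <-]].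
Qed.

(** If [P] failed for the rectangle [[x0, x0 + h] x [y0, y0 + k]], it would fail
    for one of its quarters, and so on; the nested rectangles shrink to a point
    [(p, q)] near which [P] holds. The third argument of [P] is the ratio of the
    sides to [h] and [k]. *)
Lemma rectangle_bisection (P : R -> R -> R -> Prop) (x0 y0 h k : R) :
  0 <= h -> 0 <= k ->
  (forall x y s, 0 < s ->
    P x y (s / 2) -> P (x + s / 2 * h) y (s / 2) ->
    P x (y + s / 2 * k) (s / 2) -> P (x + s / 2 * h) (y + s / 2 * k) (s / 2) ->
    P x y s) ->
  (forall p q, x0 <= p <= x0 + h -> y0 <= q <= y0 + k ->
    exists2 d, 0 < d & forall x y s, 0 < s < d ->
      x <= p <= x + s * h -> y <= q <= y + s * k -> P x y s) ->
  P x0 y0 1.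
Proof.
move=> h0 k0 Pstep Ploc; apply: contrapT => nP.
pose s n : R := 2^-1 ^+ n.
have s_gt0 n : 0 < s n by rewrite exprn_gt0.
have sS n : s n.+1 = s n / 2 by rewrite /s exprSr.
pose nxt n (u : R * R) (e : bool * bool) :=
  (u.1 + e.1%:R * (s n.+1 * h), u.2 + e.2%:R * (s n.+1 * k)).
have /choice[F HF] : forall nu : nat * (R * R), exists e,
    ~ P nu.2.1 nu.2.2 (s nu.1) ->
    ~ P (nxt nu.1 nu.2 e).1 (nxt nu.1 nu.2 e).2 (s nu.1.+1).
  move=> [n [x y]] /=; apply: contrapT => nE.
  have A e : ~ P x y (s n) /\
     P (nxt n (x, y) e).1 (nxt n (x, y) e).2 (s n.+1).
    by split; apply: contrapT => B; apply: nE; exists e => // /B.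
  have [nPn _] := A (true, true); apply: nPn.
  have := A (true, true); have := A (true, false).
  have := A (false, true); have := A (false, false).
  rewrite /nxt /= !mul0r !addr0 !mul1r sS => -[_ B1] [_ B2] [_ B3] [_ B4].
  exact: Pstep.
pose fix u n : R * R :=
  if n is m.+1 then nxt m (u m) (F (m, u m)) else (x0, y0).
have nPu n : ~ P (u n).1 (u n).2 (s n).
  by elim: n => [|n IH] //=; apply: (HF (n, u n)).
have [|p Hp] := @nested_bisection (fun n => (u n).1) h h0.
  by move=> n; exists (F (n, u n)).1.
have [|q Hq] := @nested_bisection (fun n => (u n).2) k k0.
  by move=> n; exists (F (n, u n)).2.
have [| |d d0 Hd] := Ploc p q.
- by have := Hp 0%N; rewrite expr0 mul1r.
- by have := Hq 0%N; rewrite expr0 mul1r.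
have [n sd] : exists n, s n < d.
  have [N _ HN] := near_infty_natSinv_expn_lt (PosNum d0).
  by exists N; have := HN N (leqnn N); rewrite /= /s exprVn div1r.
by apply: (nPu n); apply: Hd; rewrite ?s_gt0 ?sd ?Hp ?Hq.
Qed.

(** The integral of [H] along the boundary of the rectangle, with opposite
    sides put under one integral sign: for an affine [H] the integrands are
    then constant. *)
Definition rect_int (H : R[i] -> R[i]) (x1 x2 y1 y2 : R) : R[i] :=
  cint x1 x2 (fun t => H (t +i* y1) - H (t +i* y2)) +
  'i * cint y1 y2 (fun t => H (x2 +i* t) - H (x1 +i* t)).

Lemma rect_int_splitx (H : R[i] -> R[i]) (x1 x2 x3 y1 y2 : R) :
  continuous (H : C -> C) -> x1 <= x2 -> x2 <= x3 ->
  rect_int H x1 x3 y1 y2 = rect_int H x1 x2 y1 y2 + rect_int H x2 x3 y1 y2.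
Proof.
move=> cH x12 x23.
have cv x := @continuous_vline H x cH; have ch y := @continuous_hline H y cH.
rewrite /rect_int (@cint_cat _ x1 x2 x3) //.
  by rewrite !cintB //; ring.
by move=> t; apply: (@cvgB _ C); exact: ch.
Qed.

Lemma rect_int_splity (H : R[i] -> R[i]) (x1 x2 y1 y2 y3 : R) :
  continuous (H : C -> C) -> y1 <= y2 -> y2 <= y3 ->
  rect_int H x1 x2 y1 y3 = rect_int H x1 x2 y1 y2 + rect_int H x1 x2 y2 y3.
Proof.
move=> cH y12 y23.
have cv x := @continuous_vline H x cH; have ch y := @continuous_hline H y cH.
rewrite /rect_int (@cint_cat _ y1 y2 y3) //.
  by rewrite !cintB //; ring.
by move=> t; apply: (@cvgB _ C); exact: cv.
Qed.

(** The affine part of [H] at [p] contributes the constants [c1] and [c2] to the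
    two integrands, and these contributions cancel in [rect_int]. *)
Lemma rect_int_le (H : R[i] -> R[i]) (x1 x2 y1 y2 M : R) (p d : R[i]) :
  continuous (H : C -> C) -> x1 <= x2 -> y1 <= y2 ->
  (forall a b, x1 <= a <= x2 -> y1 <= b <= y2 ->
    normc (H (a +i* b) - H p - d * (a +i* b - p)) <= M) ->
  normc (rect_int H x1 x2 y1 y2) <= 4 * M * ((x2 - x1) + (y2 - y1)).
Proof.
move=> cH x12 y12 HM.
have cv x := @continuous_vline H x cH; have ch y := @continuous_hline H y cH.
pose c1 := - (d * 'i * (y2 - y1)%:C); pose c2 := d * (x2 - x1)%:C.
pose f1 t := H (t +i* y1) - H (t +i* y2).
pose f2 t := H (x2 +i* t) - H (x1 +i* t).
have cf1 : continuous (f1 : R -> C).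
  by move=> t; apply: (@cvgB _ C); exact: ch.
have cf2 : continuous (f2 : R -> C).
  by move=> t; apply: (@cvgB _ C); exact: cv.
have cg1 : continuous ((fun t => f1 t - c1) : R -> C).
  by move=> t; apply: (@cvgB _ C); [exact: cf1|exact: cvg_cst].
have cg2 : continuous ((fun t => f2 t - c2) : R -> C).
  by move=> t; apply: (@cvgB _ C); [exact: cf2|exact: cvg_cst].
have -> : rect_int H x1 x2 y1 y2 =
    cint x1 x2 (fun t => f1 t - c1) + 'i * cint y1 y2 (fun t => f2 t - c2).
  rewrite (@cintB R x1 x2 f1 (fun=> c1) cf1 (@continuous_ccst R _ c1)).
  rewrite (@cintB R y1 y2 f2 (fun=> c2) cf2 (@continuous_ccst R _ c2)).
  rewrite !cint_cst //.
  rewrite -[rect_int _ _ _ _ _]/(cint x1 x2 f1 + 'i * cint y1 y2 f2).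
  move: (cint x1 x2 f1) (cint y1 y2 f2) => I1 I2.
  rewrite /c1 /c2; ring.
have M2 (z w : R[i]) : normc z <= M -> normc w <= M -> normc (z - w) <= 2 * M.
  move=> zM wM; apply: le_trans (le_normcD _ _) _.
  by rewrite normcN mulr_natl mulr2n lerD.
apply: le_trans (le_normcD _ _) _; rewrite normcM.
have -> : normc ('i : R[i]) = 1.
  by rewrite /ComplexField.Normc.normc /= expr0n expr1n add0r sqrtr1.
rewrite mul1r mulrDr; apply: lerD.
- have -> : 4 * M * (x2 - x1) = 2 * ((2 * M) * (x2 - x1)) by ring.
  apply: (normc_cint_le cg1 x12) => t tx.
  have := M2 _ _ (HM t y1 tx _) (HM t y2 tx _).
  rewrite lexx y12 lexx => /(_ isT isT).
  congr (normc _ <= _); rewrite /f1 /c1.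
  have -> : t +i* y1 = t%:C + 'i * y1%:C by simpc.
  have -> : t +i* y2 = t%:C + 'i * y2%:C by simpc.
  by rewrite rmorphB; ring.
- have -> : 4 * M * (y2 - y1) = 2 * ((2 * M) * (y2 - y1)) by ring.
  apply: (normc_cint_le cg2 y12) => t ty.
  have := M2 _ _ (HM x2 t _ ty) (HM x1 t _ ty).
  rewrite lexx x12 lexx => /(_ isT isT).
  congr (normc _ <= _); rewrite /f2 /c2.
  have -> : x2 +i* t = x2%:C + 'i * t%:C by simpc.
  have -> : x1 +i* t = x1%:C + 'i * t%:C by simpc.
  by rewrite rmorphB; ring.
Qed.

(** The bound [e * s ^+ 2] is inherited from the four quarters, and the
    derivative gives it for small rectangles: there [H] is affine up to an error
    proportional to [s], integrated over a length proportional to [s]. *)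
Theorem goursat (H : R[i] -> R[i]) (x1 x2 y1 y2 : R) :
  continuous (H : C -> C) -> x1 < x2 -> y1 < y2 ->
  (forall a b, x1 <= a <= x2 -> y1 <= b <= y2 ->
    derivable (H : C -> C) (a +i* b) 1) ->
  rect_int H x1 x2 y1 y2 = 0.
Proof.
move=> cH x12 y12 dH.
pose h := x2 - x1; pose k := y2 - y1.
have h0 : 0 < h by rewrite subr_gt0.
have k0 : 0 < k by rewrite subr_gt0.
apply/eqP; rewrite -normc_eq0 eq_le normc_ge0 andbT.
apply/ler_addgt0Pr => e e0; rewrite add0r.
pose P x y s := normc (rect_int H x (x + s * h) y (y + s * k)) <= e * s ^+ 2.
suff : P x1 y1 1 by rewrite /P !mul1r expr1n mulr1 /h /k !subrKC.
apply: (@rectangle_bisection P x1 y1 h k (ltW h0) (ltW k0)).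
- move=> x y s s0; rewrite /P.
  have E (u v : R) : u + s / 2 * v + s / 2 * v = u + s * v by field.
  have L (u v : R) : 0 < v -> u <= u + s / 2 * v.
    by move=> v0; rewrite lerDl; apply/ltW/mulr_gt0 => //; rewrite divr_gt0.
  have L' (u v : R) : 0 < v -> u + s / 2 * v <= u + s * v.
    by move=> v0; rewrite -E; exact: L.
  rewrite !E => B1 B2 B3 B4.
  rewrite (@rect_int_splitx _ _ (x + s / 2 * h)) ?L ?L' //.
  rewrite !(@rect_int_splity _ _ _ y (y + s / 2 * k) (y + s * k)) ?L ?L' //.
  do 3?[apply: le_trans (le_normcD _ _) _].
  apply: le_trans (lerD (le_normcD _ _) (le_normcD _ _)) _.
  apply: le_trans (lerD (lerD B1 B3) (lerD B2 B4)) _.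
  by rewrite le_eqVlt; apply/orP; left; apply/eqP; field.
- move=> p q.
  have -> : x1 + h = x2 by rewrite /h subrKC.
  have -> : y1 + k = y2 by rewrite /k subrKC.
  move=> px qy.
  have [d Hd] := derivable_cderiv (dH _ _ px qy).
  have hk0 : 0 < h + k by rewrite addr_gt0.
  pose e' := e / (4 * (h + k) ^+ 2).
  have e'0 : 0 < e' by rewrite divr_gt0 // mulr_gt0 // exprn_gt0.
  have [dl dl0 Hdl] := Hd _ e'0.
  exists (dl / (h + k)); first by rewrite divr_gt0.
  move=> x y s /andP[s0 sd] px' qy'.
  rewrite ltr_pdivlMr // in sd.
  have sh : 0 < s * h by rewrite mulr_gt0.
  have sk : 0 < s * k by rewrite mulr_gt0.
  rewrite /P.
  pose M := e' * (s * (h + k)).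
  apply: le_trans (@rect_int_le _ _ _ _ _ M (p +i* q) d _ _ _ _) _ => //.
  + by rewrite lerDl ltW.
  + by rewrite lerDl ltW.
  + move=> a b ax bY.
    have D : normc (a +i* b - (p +i* q)) <= s * (h + k).
      apply: le_trans (normc_le _) _; rewrite /= mulrDr.
      move: px' qy' ax bY => /andP[? ?] /andP[? ?] /andP[? ?] /andP[? ?].
      by apply: lerD; rewrite ler_norml; apply/andP; split; lra.
    apply: le_trans (Hdl _ (le_lt_trans D sd)) _.
    by rewrite ler_pM2l.
  + rewrite le_eqVlt; apply/orP; left; apply/eqP; rewrite /M /e'; field.
    by rewrite gt_eqF.
Qed.

End goursat.

(** * Periodic functions: integrals over vertical periods *)

Section strip.
Variable R : realType.
Local Notation C := (R[i]^o).

Definition period_int (H : R[i] -> R[i]) (s : R) : R[i] :=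
  cint 0 (pi *+ 2) (fun t => H (s +i* t)).

Let pi2_gt0 : 0 < pi *+ 2 :> R.
Proof. by rewrite mulrn_wgt0 // pi_gt0. Qed.

Lemma period_int_le (H : R[i] -> R[i]) (s M : R) : continuous (H : C -> C) ->
  (forall t, 0 <= t <= pi *+ 2 -> normc (H (s +i* t)) <= M) ->
  normc (period_int H s) <= 4 * pi * M.
Proof.
move=> cH HM; have -> : 4 * pi * M = 2 * (M * (pi *+ 2 - 0)) by ring.
by apply: normc_cint_le => //; [exact: continuous_vline|exact: ltW].
Qed.

(** On a rectangle of height [2 * pi] the two horizontal sides cancel by
    periodicity. *)
Lemma period_int_const (H : R[i] -> R[i]) (s1 s2 : R) :
  continuous (H : C -> C) ->
  (forall a b, H (a +i* (b + pi *+ 2)) = H (a +i* b)) ->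
  s1 < s2 ->
  (forall a b, s1 <= a <= s2 -> derivable (H : C -> C) (a +i* b) 1) ->
  period_int H s1 = period_int H s2.
Proof.
move=> cH pH s12 dH.
have := goursat cH s12 pi2_gt0 (fun a b sa _ => dH a b sa).
rewrite /rect_int (@eq_cint _ s1 s2 _ (fun=> 0)).
  rewrite cint_cst ?ltW // mul0r add0r cintB; try exact: continuous_vline.
  have i0 : ('i : R[i]) != 0 by rewrite eq_complex /= oner_eq0 andbF.
  move=> /eqP; rewrite mulf_eq0 (negbTE i0) subr_eq0 => /eqP E.
  by rewrite /period_int E.
by move=> t _; rewrite -[X in _ - H (_ +i* X)]add0r pH subrr.
Qed.

Lemma continuous_period_int (H : R[i] -> R[i]) (s0 e : R) :
  continuous (H : C -> C) -> 0 < e ->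
  exists2 d, 0 < d & forall s, `|s - s0| < d ->
    normc (period_int H s - period_int H s0) < e.
Proof.
move=> cH e0.
pose e' := e / (8 * pi).
have p0 : 0 < 8 * pi :> R by rewrite mulr_gt0 // pi_gt0.
have e'0 : 0 < e' by rewrite divr_gt0.
have cov : near_covering (`[0, pi *+ 2] : set R).
  exact/compact_near_coveringP/segment_compact.
have : \forall s \near nbhs s0,
    `[0, pi *+ 2] `<=` [set t | normc (H (s +i* t) - H (s0 +i* t)) <= e'].
  apply: (cov R (nbhs s0)
    (fun s t => normc (H (s +i* t) - H (s0 +i* t)) <= e')).
  move=> t _.
  have e'20 : 0 < e' / 2 by rewrite divr_gt0.
  have /cvgCP /(_ _ e'20) := cH (s0 +i* t).
  move=> /nbhsCP[d d0 Hd].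
  have d20 : 0 < d / 2 by rewrite divr_gt0.
  exists (ball t (d / 2), ball s0 (d / 2)) => /=.
    by split; apply: nbhsx_ballx.
  move=> [t' s] /=; rewrite -!ball_normE /= => -[tt' ss'].
  have A : normc (s +i* t' - (s0 +i* t)) < d.
    apply: le_lt_trans (normc_le _) _; rewrite /=.
    by rewrite distrC in ss'; rewrite distrC in tt'; lra.
  have B : normc (s0 +i* t' - (s0 +i* t)) < d.
    apply: le_lt_trans (normc_le _) _; rewrite /= subrr normr0 add0r.
    by rewrite distrC in tt'; lra.
  rewrite -(subrKA (H (s0 +i* t))); apply: le_trans (le_normcD _ _) _.
  rewrite (normc_distC (H (s0 +i* t))).
  have := Hd _ A; have := Hd _ B; lra.
move=> /nbhs_ballP[d /= d0 Hd]; exists d => // s sd.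
rewrite -cintB; try exact: continuous_vline.
have -> : e = 2 * (2 * (e' * (pi *+ 2 - 0))).
  rewrite /e'; have := @pi_gt0 R; move: (pi : R) => x x0.
  by field; rewrite gt_eqF.
apply: (@le_lt_trans _ _ (2 * (e' * (pi *+ 2 - 0)))).
  apply: normc_cint_le; last 2 first.
  - exact: ltW.
  - move=> t tp; apply: Hd; last by rewrite /= in_itv.
    by rewrite -ball_normE /= distrC.
  move=> t; apply: (@cvgB _ C); exact: continuous_vline.
by rewrite ltr_pMl ?ltr1n // mulr_gt0 // mulr_gt0 // subr0.
Qed.

(** Constancy survives an exceptional line on which [H] is merely continuous:
    the integral is constant on each side of it and continuous across it. *)
Lemma period_int_const_off_line (H : R[i] -> R[i]) (c s1 s2 : R) :
  continuous (H : C -> C) ->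
  (forall a b, H (a +i* (b + pi *+ 2)) = H (a +i* b)) ->
  (forall a b, a != c -> derivable (H : C -> C) (a +i* b) 1) ->
  period_int H s1 = period_int H s2.
Proof.
move=> cH pH dH.
suff K s : period_int H s = period_int H c by rewrite !K.
apply/eqP; rewrite -subr_eq0 -normc_eq0 eq_le normc_ge0 andbT.
apply/ler_addgt0Pr => e e0; rewrite add0r.
have [d d0 Hd] := continuous_period_int c cH e0.
have d20 : 0 < d / 2 by rewrite divr_gt0.
have [sc|cs|->] := ltgtP s c;
  last by rewrite subrr ComplexField.Normc.normc0 ltW.
- pose s' := Num.max s (c - d / 2).
  have s'c : s' < c by rewrite gt_max sc; lra.
  have -> : period_int H s = period_int H s'.
    have [<- //|ss'] := eqVneq s s'.
    apply: period_int_const => //.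
      by rewrite lt_neqAle ss' le_max lexx.
    by move=> a b /andP[_ h]; apply: dH; rewrite lt_eqF // (le_lt_trans h).
  apply/ltW/Hd; have : c - d / 2 <= s' by rewrite le_max lexx orbT.
  by rewrite ltr_norml; lra.
- pose s' := Num.min s (c + d / 2).
  have s'c : c < s' by rewrite lt_min cs; lra.
  have -> : period_int H s = period_int H s'.
    have [<- //|ss'] := eqVneq s s'.
    symmetry; apply: period_int_const => //.
      by rewrite lt_neqAle eq_sym ss' ge_min lexx.
    by move=> a b /andP[h _]; apply: dH; rewrite gt_eqF // (lt_le_trans _ h).
  apply/ltW/Hd; have : s' <= c + d / 2 by rewrite ge_min lexx orbT.
  by rewrite ltr_norml; lra.
Qed.

End strip.

(** * Cauchy's formula, Taylor expansion and the identity theorem *)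

Section taylor.
Variable R : realType.
Local Notation C := (R[i]^o).

Lemma derivable_continuous_at (f : C -> C) (p : C) :
  derivable f p 1 -> {for p, continuous f}.
Proof. by move=> /derivable1_diffP; exact: differentiable_continuous. Qed.

Lemma entire_continuous (g : R[i] -> R[i]) :
  entire g -> continuous (g : C -> C).
Proof. by move=> eg p; apply: derivable_continuous_at; exact: eg. Qed.

Lemma cderivableM (f g : R[i] -> R[i]) (p : R[i]) :
  derivable (f : C -> C) p 1 -> derivable (g : C -> C) p 1 ->
  derivable ((fun w => f w * g w) : C -> C) p 1.
Proof. by move=> df dg; have D := derivableM df dg; exact: D. Qed.

Lemma cderivableB (f g : R[i] -> R[i]) (p : R[i]) :
  derivable (f : C -> C) p 1 -> derivable (g : C -> C) p 1 ->
  derivable ((fun w => f w - g w) : C -> C) p 1.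
Proof. by move=> df dg; have D := derivableB df dg; exact: D. Qed.

Lemma cderivableV (f : R[i] -> R[i]) (p : R[i]) : f p != 0 ->
  derivable (f : C -> C) p 1 -> derivable ((fun w => (f w)^-1) : C -> C) p 1.
Proof. by move=> fp df; have D := derivableV fp df; exact: D. Qed.

Lemma derivable_comp_cexp (f : C -> C) (w : C) : derivable f (cexp w) 1 ->
  derivable ((fun u => f (cexp u)) : C -> C) w 1.
Proof.
move=> /derivable1_diffP df; apply/derivable1_diffP.
have de : differentiable (@cexp R : C -> C) w.
  exact/derivable1_diffP/derivable_cexp.
exact: differentiable_comp de df.
Qed.

Lemma continuous_comp_cexp (f : R[i] -> R[i]) : continuous (f : C -> C) ->
  continuous ((fun u => f (cexp u)) : C -> C).
Proof.
move=> cf w.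
have D := @continuous_comp C C C (@cexp R) f w (@continuous_cexp R w) (cf _).
exact: D.
Qed.

Lemma derivable_cexpVn (n : nat) (w : C) :
  derivable ((fun u => (cexp u)^-1 ^+ n) : C -> C) w 1.
Proof.
elim: n => [|n IH].
  by under eq_fun do rewrite expr0; exact: derivable_cst.
under eq_fun do rewrite exprS.
apply: (@cderivableM (fun u => (cexp u)^-1) (fun u => (cexp u)^-1 ^+ n));
  last exact: IH.
apply: (@cderivableV (@cexp R)); first exact: cexp_neq0.
exact: derivable_cexp.
Qed.

Lemma continuous_cexpVn (n : nat) :
  continuous ((fun u => (cexp u)^-1 ^+ n) : C -> C).
Proof.
by move=> w; apply: derivable_continuous_at; exact: derivable_cexpVn.
Qed.

Lemma normc_cexpVn (n : nat) (s t : R) :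
  normc ((cexp (s +i* t))^-1 ^+ n) = (expR s)^-1 ^+ n.
Proof. by rewrite normcX normcV normc_cexp. Qed.

Lemma period_int_cexpV0 (s : R) :
  period_int (fun w => (cexp w)^-1 ^+ 0) s = (2 * pi)%:C.
Proof.
rewrite /period_int (@eq_cint _ _ _ _ (fun=> 1)); last first.
  by move=> t _; rewrite expr0.
rewrite cint_cst ?mul1r ?subr0 ?mulr_natl //.
by rewrite mulrn_wge0 // pi_ge0.
Qed.

(** The integral does not depend on [s] and tends to [0] as [s] tends to
    infinity; it is evaluated at [s = - ln x] with [x] small. *)
Lemma period_int_cexpVn (n : nat) (s : R) :
  period_int (fun w => (cexp w)^-1 ^+ n.+1) s = 0.
Proof.
apply/eqP; rewrite -normc_eq0 eq_le normc_ge0 andbT.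
apply/ler_addgt0Pr => e e0; rewrite add0r.
have p0 : 0 < 4 * pi :> R by rewrite mulr_gt0 // pi_gt0.
pose x := Num.min 1 (e / (4 * pi)).
have x0 : 0 < x by rewrite lt_min ltr01 divr_gt0.
rewrite (@period_int_const_off_line _ _ 0 s (- ln x)).
- apply: le_trans (period_int_le (M := x ^+ n.+1) _ _) _.
  + exact: continuous_cexpVn.
  + by move=> t _; rewrite normc_cexpVn expRN lnK ?invrK.
  + rewrite mulrC -ler_pdivlMr //; apply: le_trans (_ : x <= _).
      rewrite exprS; apply: ler_piMr; first exact: ltW.
      by apply: exprn_ile1; [exact: ltW|rewrite /x ge_min lexx].
    by rewrite /x ge_min lexx orbT.
- exact: continuous_cexpVn.
- by move=> a b; rewrite cexp_periodic.
- by move=> a b _; exact: derivable_cexpVn.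
Qed.

Definition diffq (g : R[i] -> R[i]) (z d w : R[i]) : R[i] :=
  if w == z then d else (g w - g z) / (w - z).

Lemma derivable_diffq (g : R[i] -> R[i]) (z d w : R[i]) :
  entire g -> w != z -> derivable (diffq g z d : C -> C) w 1.
Proof.
move=> eg wz.
apply: (@near_eq_derivable _ C C (fun u => (g u - g z) * (u - z)^-1)).
  apply/nbhsCP; exists (normc (w - z)) => [|u uw].
    by rewrite normc_gt0 subr_eq0.
  rewrite /diffq ifN //; apply: contraTneq uw => ->.
  by rewrite normc_distC ltxx.
apply: (@cderivableM (fun u => g u - g z) (fun u => (u - z)^-1)).
  by apply: (@cderivableB g (cst (g z))); [exact: eg|exact: derivable_cst].
apply: (@cderivableV (fun u => u - z)); first by rewrite subr_eq0.
by apply: (@cderivableB id (cst z)); [exact: derivable_id|exact: derivable_cst].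
Qed.

Lemma continuous_diffq (g : R[i] -> R[i]) (z d : R[i]) :
  entire g -> cderiv g z d -> continuous (diffq g z d : C -> C).
Proof.
move=> eg gd w; have [->|wz] := eqVneq w z; last first.
  by apply: derivable_continuous_at; exact: derivable_diffq.
apply/continuousCP => e e0; have e20 : 0 < e / 2 by rewrite divr_gt0.
have [dl dl0 Hdl] := gd _ e20; exists dl => // u uz.
rewrite /diffq eqxx; case: eqVneq => [_|unz].
  by rewrite subrr ComplexField.Normc.normc0.
have uz0 : u - z != 0 by rewrite subr_eq0.
rewrite -(ltr_pM2r (x := normc (u - z))) ?normc_gt0 // -normcM.
have -> : ((g u - g z) / (u - z) - d) * (u - z) = g u - g z - d * (u - z).
  by field.
apply: le_lt_trans (Hdl _ uz) _; rewrite ltr_pM2r ?normc_gt0 //; lra.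
Qed.

(** Cauchy's formula. The points [w] with [cexp w = z] lie on one vertical line,
    so the integral does not depend on [s], and it tends to [0] as [s] tends to
    minus infinity because of the factor [cexp w]. *)
Lemma cauchy_diffq (g : R[i] -> R[i]) (z d : R[i]) (s : R) :
  entire g -> cderiv g z d ->
  period_int (fun w => diffq g z d (cexp w) * cexp w) s = 0.
Proof.
move=> eg gd; have cq := continuous_diffq eg gd.
pose H w := diffq g z d (cexp w) * cexp w.
have cH : continuous (H : C -> C).
  exact: continuous_cM (continuous_comp_cexp cq) (@continuous_cexp R).
have pH a b : H (a +i* (b + pi *+ 2)) = H (a +i* b) by rewrite /H cexp_periodic.
have dH a b : a != ln (normc z) -> derivable (H : C -> C) (a +i* b) 1.
  move=> az; apply: (@cderivableM (fun w => diffq g z d (cexp w)) (@cexp R)).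
    apply: derivable_comp_cexp; apply: derivable_diffq => //.
    by apply: contraNneq az => <-; rewrite normc_cexp expRK.
  exact: derivable_cexp.
apply/eqP; rewrite -normc_eq0 eq_le normc_ge0 andbT.
apply/ler_addgt0Pr => e e0; rewrite add0r.
have p0 : 0 < 4 * pi :> R by rewrite mulr_gt0 // pi_gt0.
have /continuousCP /(_ _ ltr01) [dl dl0 Hdl] := cq 0.
pose B := normc (diffq g z d 0) + 1.
have B0 : 0 < B by rewrite ltr_wpDl // normc_ge0.
pose x := Num.min (dl / 2) (e / (4 * pi * B)).
have x0 : 0 < x by rewrite lt_min !divr_gt0 // mulr_gt0.
rewrite -/H (period_int_const_off_line s (ln x) cH pH dH).
apply: le_trans (period_int_le (M := B * x) cH _) _ => [t _|].
  have nx : normc (cexp (ln x +i* t)) = x by rewrite normc_cexp lnK.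
  rewrite /H normcM nx ler_pM2r // /B.
  rewrite -[diffq _ _ _ _](subrK (diffq g z d 0)) addrC.
  apply: le_trans (le_normcD _ _) _; rewrite lerD2l; apply/ltW/Hdl.
  rewrite subr0 nx; apply: le_lt_trans (_ : x <= dl / 2) _; last by lra.
  by rewrite /x ge_min lexx.
rewrite mulrA mulrC -ler_pdivlMr; last exact: mulr_gt0.
by rewrite /x ge_min lexx orbT.
Qed.

Lemma geometric_kernel (n : nat) (z w : R[i]) : w != 0 -> w != z ->
  w / (w - z) = \sum_(j < n) z ^+ j * w^-1 ^+ j
                + z ^+ n * w^-1 ^+ n * (w / (w - z)).
Proof.
move=> w0 wz; have wz0 : w - z != 0 by rewrite subr_eq0.
elim: n => [|n IH]; first by rewrite big_ord0 !expr0 add0r !mul1r.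
rewrite {1}IH big_ord_recr /= -addrA; congr (_ + _).
by rewrite !exprS; move: (w^-1 ^+ n) (z ^+ n) => a b; field; rewrite w0 wz0.
Qed.

(** The bound decays in [n] at a fixed [z] and in [z] at a fixed [n], with the
    same coefficients throughout. The modulus of [g z] appears because the
    difference quotient at [z] is bounded on the circle of radius [r] by
    [(M + normc (g z)) / (r / 2)], where [M] bounds [g] there. *)
Theorem taylor_remainder (g : R[i] -> R[i]) (r : R) : entire g -> 0 < r ->
  exists (A : nat -> R[i]) (M : R), forall n z, normc z <= r / 2 ->
    normc (g z - \sum_(j < n.+1) A j * z ^+ j) <=
    4 * (M + normc (g z)) * (normc z / r) ^+ n.+1.
Proof.
move=> eg r0; pose s := ln r.
have es : expR s = r by rewrite lnK.
have p0 : 0 < 2 * pi :> R by rewrite mulr_gt0 // pi_gt0.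
have cg : continuous ((fun w => g (cexp w)) : C -> C).
  exact: continuous_comp_cexp (entire_continuous eg).
have [M HM] : exists M, forall t, 0 <= t <= pi *+ 2 ->
    normc (g (cexp (s +i* t))) <= M.
  have [| |c _ Hc] :=
    @EVT_max R (fun t => normc (g (cexp (s +i* t)))) 0 (pi *+ 2).
  - by rewrite mulrn_wge0 // pi_ge0.
  - apply: continuous_subspaceT => t.
    apply: (@continuous_comp _ C _ (fun t => g (cexp (s +i* t))) (@normc R)).
      by apply: (continuous_vline cg).
    exact: continuous_normc.
  by exists (normc (g (cexp (s +i* c)))) => t tp; apply: Hc; rewrite in_itv.
pose HA j w := g (cexp w) * (cexp w)^-1 ^+ j.
have cHA j : continuous (HA j : C -> C).
  exact: continuous_cM cg (@continuous_cexpVn j).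
exists (fun j => (2 * pi)^-1%:C * period_int (HA j) s), M => n z zr.
have [d gd] := derivable_cderiv (eg z).
pose q w := diffq g z d (cexp w) * cexp w.
have cq : continuous (q : C -> C).
  apply: continuous_cM (@continuous_cexp R).
  exact: continuous_comp_cexp (continuous_diffq eg gd).
pose HJ w := (cexp w)^-1 ^+ n.+1 * q w.
have cHJ : continuous (HJ : C -> C).
  exact: continuous_cM (@continuous_cexpVn n.+1) cq.
pose J := period_int HJ s.
have zne t : cexp (s +i* t) != z.
  apply: contraTneq zr => <-; rewrite normc_cexp es -ltNge.
  by rewrite ltr_pdivrMr // ltr_pMr // ltr1n.
have key t : q (s +i* t) =
    \sum_(j < n.+1) (z ^+ j * HA j (s +i* t)
      - z ^+ j * g z * (cexp (s +i* t))^-1 ^+ j) + z ^+ n.+1 * HJ (s +i* t).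
  rewrite /HJ /q /diffq ifN //.
  have -> : (g (cexp (s +i* t)) - g z) / (cexp (s +i* t) - z) * cexp (s +i* t)
     = (g (cexp (s +i* t)) - g z) * (cexp (s +i* t) / (cexp (s +i* t) - z)).
    by ring.
  rewrite {1}(@geometric_kernel n.+1 z) ?cexp_neq0 // mulrDr; congr (_ + _).
    by rewrite mulr_sumr; apply: eq_bigr => j _; rewrite /HA; ring.
  by ring.
have := cauchy_diffq s eg gd; rewrite -/q /period_int.
have cV j := @continuous_vline R _ s (@continuous_cexpVn j).
have cA j := @continuous_vline R _ s (cHA j).
have cJ := @continuous_vline R _ s cHJ.
have cstM (c : R[i]) (f : R -> R[i]) : continuous (f : R -> C) ->
   continuous ((fun t => c * f t) : R -> C).
  exact: continuous_cM (@continuous_ccst R _ c).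
pose S j t := z ^+ j * HA j (s +i* t) - z ^+ j * g z * (cexp (s +i* t))^-1 ^+ j.
have cS j : continuous (S j : R -> C).
  exact: continuous_cB (cstM _ _ (cA j)) (cstM _ _ (cV j)).
rewrite (@eq_cint _ _ _ _
  (fun t => \sum_(j < n.+1) S j t + z ^+ n.+1 * HJ (s +i* t))); last first.
  by move=> t _; rewrite key.
rewrite cintD; [|exact: continuous_csum|exact: cstM].
rewrite cint_sum //; last by rewrite mulrn_wge0 // pi_ge0.
rewrite cintZ // -[cint _ _ _]/J.
have -> : \sum_(j < n.+1) cint 0 (pi *+ 2) (S j) =
    \sum_(j < n.+1) (z ^+ j * period_int (HA j) s) - g z * (2 * pi)%:C.
  have E j : cint 0 (pi *+ 2) (S j) = z ^+ j * period_int (HA j) s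
      - z ^+ j * g z * period_int (fun w => (cexp w)^-1 ^+ j) s.
    have E1 := @cintB R 0 (pi *+ 2) _ _ (cstM (z ^+ j) _ (cA j))
      (cstM (z ^+ j * g z) _ (cV j)).
    have E2 := @cintZ R 0 (pi *+ 2) (z ^+ j) _ (cA j).
    have E3 := @cintZ R 0 (pi *+ 2) (z ^+ j * g z) _ (cV j).
    by rewrite E2 E3 in E1; exact: E1.
  under eq_bigr do rewrite E.
  rewrite sumrB; congr (_ - _).
  rewrite big_ord_recl /= big1 => [|j _].
    by rewrite addr0 expr0 mul1r period_int_cexpV0.
  by rewrite period_int_cexpVn mulr0.
move=> E.
have pC : (2 * pi : R)%:C != 0 by rewrite eq_complex /= eqxx andbT gt_eqF.
have -> : g z - \sum_(j < n.+1) (2 * pi)^-1%:C * period_int (HA j) s * z ^+ j =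
    (2 * pi)^-1%:C * (z ^+ n.+1 * J).
  have -> : z ^+ n.+1 * J = g z * (2 * pi)%:C
     - \sum_(j < n.+1) (z ^+ j * period_int (HA j) s).
    by move: E => /eqP; rewrite addrC addr_eq0 => /eqP ->; rewrite opprB.
  rewrite mulrBr mulr_sumr fmorphV mulrCA mulVf // mulr1; congr (_ - _).
  by apply: eq_bigr => j _; ring.
rewrite !normcM normcX normc_real ger0_norm; last by rewrite invr_ge0 ltW.
have MJ : normc J <= 4 * pi * (r^-1 ^+ n.+1 * (2 * (M + normc (g z)))).
  apply: period_int_le => // t tp.
  rewrite /HJ normcM normc_cexpVn es ler_pM2l ?exprn_gt0 ?invr_gt0 //.
  rewrite /q /diffq ifN // normcM normc_cexp normcM normcV es.
  have zd : r / 2 <= normc (cexp (s +i* t) - z).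
    have := le_normcD (cexp (s +i* t) - z) z.
    by rewrite subrK normc_cexp es; lra.
  have r20 : 0 < r / 2 by rewrite divr_gt0.
  have zd0 := lt_le_trans r20 zd.
  have MG : normc (g (cexp (s +i* t)) - g z) <= M + normc (g z).
    by apply: le_trans (le_normcD _ _) _; rewrite normcN lerD2r HM.
  rewrite -mulrA mulrC; apply: ler_pM => //; rewrite ?normc_ge0 //.
    by apply: mulr_ge0; rewrite ?invr_ge0 ltW.
  by rewrite mulrC ler_pdivrMr //; lra.
have pi0 := @pi_gt0 R.
have zn0 : 0 <= normc z ^+ n.+1 by rewrite exprn_ge0 // normc_ge0.
apply: le_trans (_ : _ <= (2 * pi)^-1 * (normc z ^+ n.+1 *
   (4 * pi * (r^-1 ^+ n.+1 * (2 * (M + normc (g z))))))) _.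
  by rewrite ler_pM2l ?invr_gt0 // ler_wpM2l.
rewrite le_eqVlt; apply/orP; left; apply/eqP.
rewrite exprMn; move: (r^-1 ^+ _) (normc z ^+ _) (M + _) => a b c.
by move: (pi : R) pi0 => p pp; field; rewrite gt_eqF.
Qed.

Lemma geometric_bound_eq0 (x B : R) : 0 <= x ->
  (forall n, x <= B * 2^-1 ^+ n.+1) -> x = 0.
Proof.
move=> x0 H; apply/eqP; rewrite eq_le x0 andbT.
apply/ler_addgt0Pr => e e0; rewrite add0r.
have B1 : 0 < `|B| + 1 by rewrite ltr_wpDl.
have eB : 0 < e / (`|B| + 1) by rewrite divr_gt0.
have [N _ HN] := near_infty_natSinv_expn_lt (PosNum eB).
have := HN N.+1 (leqnSn N); rewrite /= div1r -exprVn ltr_pdivlMr // => h.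
apply: le_trans (H N) _; apply: le_trans (ltW h).
rewrite mulrC ler_pM2l ?exprn_gt0 ?invr_gt0 //.
by apply: le_trans (ler_norm _) _; rewrite lerDl.
Qed.

(** The radius of the expansion is chosen as [2 * normc z], so that the powers
    in the remainder at [z] are powers of [1 / 2]. *)
Theorem identity_theorem (g : R[i] -> R[i]) : entire g ->
  (forall d : R, 0 < d -> exists2 z, z != 0 /\ normc z < d & g z = 0) ->
  forall z, g z = 0.
Proof.
move=> eg gz.
have nz0 z : z != 0 -> g z = 0.
  move=> z0; pose r := 2 * normc z.
  have zp : 0 < normc z by rewrite normc_gt0.
  have r0 : 0 < r by rewrite mulr_gt0.
  have [A [M HA]] := taylor_remainder eg r0.
  have A0 n : A n = 0.
    elim/ltn_ind: n => n IH.
    apply/eqP; rewrite -normc_eq0 eq_le normc_ge0 andbT.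
    apply/ler_addgt0Pr => e e0; rewrite add0r.
    pose B := 4 * M * r^-1 ^+ n.+1.
    have B1 : 0 < `|B| + 1 by rewrite ltr_wpDl.
    pose dl := Num.min (r / 2) (e / (`|B| + 1)).
    have dl0 : 0 < dl by rewrite lt_min !divr_gt0.
    have [w [w0 wd] gw] := gz _ dl0.
    have wp : 0 < normc w by rewrite normc_gt0.
    move: wd; rewrite lt_min => /andP[wr we].
    have := HA n w (ltW wr).
    rewrite gw big_ord_recr /= big1 => [|j _]; last first.
      by rewrite IH ?mul0r.
    rewrite ComplexField.Normc.normc0 addr0 !add0r normcN normcM normcX.
    have -> : 4 * M * (normc w / r) ^+ n.+1 = (B * normc w) * normc w ^+ n.
      by rewrite /B exprMn exprS; ring.
    rewrite ler_pM2r ?exprn_gt0 // => /le_trans; apply.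
    rewrite ltr_pdivlMr // in we; apply: le_trans (ltW we).
    rewrite mulrC ler_pM2l //.
    by apply: le_trans (ler_norm _) _; rewrite lerDl.
  apply/eqP; rewrite -normc_eq0; apply/eqP.
  apply: (@geometric_bound_eq0 _ (4 * (M + normc (g z)))).
    exact: normc_ge0.
  move=> n; have := HA n z; rewrite big1 => [|j _]; last by rewrite A0 mul0r.
  rewrite subr0 /r; have -> : 2 * normc z / 2 = normc z by field.
  have -> : normc z / (2 * normc z) = 2^-1 by field; rewrite gt_eqF.
  exact.
move=> z; have [->|] := eqVneq z 0; last exact: nz0.
apply/eqP; rewrite -normc_eq0 eq_le normc_ge0 andbT.
apply/ler_addgt0Pr => e e0; rewrite add0r.
have /continuousCP /(_ _ e0) [d d0 Hd] := @entire_continuous g eg 0.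
have [w [w0 wd] gw] := gz _ d0.
by have := Hd w; rewrite subr0 gw sub0r normcN => /(_ wd) /ltW.
Qed.

End taylor.

(** * Real parts and functions within distance one *)

Section reflection.
Variable R : realType.
Local Notation C := (R[i]^o).

Lemma normc_conj (z : R[i]) : normc z^*%C = normc z.
Proof. by case: z => a b; rewrite /ComplexField.Normc.normc /= sqrrN. Qed.

Lemma entire_reflection (g : R[i] -> R[i]) : entire g ->
  entire (fun z => (g z^*%C)^*%C).
Proof.
move=> eg p; have [d gd] := derivable_cderiv (eg p^*%C).
apply: (cderiv_derivable (d := d^*%C)) => e e0.
have [dl dl0 H] := gd _ e0; exists dl => // w wp.
have E : normc (w^*%C - p^*%C) = normc (w - p) by rewrite -rmorphB normc_conj.
have := H w^*%C; rewrite E => /(_ wp).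
suff -> : (g w^*%C)^*%C - (g p^*%C)^*%C - d^*%C * (w - p) =
  (g w^*%C - g p^*%C - d * (w^*%C - p^*%C))^*%C by rewrite normc_conj.
by rewrite [RHS]rmorphB [in RHS]rmorphB rmorphM [in RHS]rmorphB /= !conjcK.
Qed.

Lemma entireD (g h : R[i] -> R[i]) : entire g -> entire h ->
  entire (fun z => g z + h z).
Proof. by move=> eg eh p; have D := derivableD (eg p) (eh p); exact: D. Qed.

(** On the real axis [Re g] is half the sum of the entire functions [g] and
    [conjc \o g \o conjc], so it obeys the identity theorem. *)
Lemma Re_identity (g : R[i] -> R[i]) : entire g ->
  (forall d : R, 0 < d -> exists2 t : R, 0 < t < d & complex.Re (g t%:C) = 0) ->
  forall x : R, complex.Re (g x%:C) = 0.
Proof.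
move=> eg gz x.
have hE t : g t%:C + (g t%:C^*%C)^*%C = (2 * complex.Re (g t%:C))%:C.
  by rewrite conjc_real addcJ rmorphM /= rmorph_nat.
have eh := entireD eg (entire_reflection eg).
have h0 := identity_theorem eh.
suff : g x%:C + (g x%:C^*%C)^*%C = 0.
  by rewrite hE => /complexI /eqP; rewrite mulf_eq0 pnatr_eq0 /= => /eqP.
apply: h0 => d /gz[t /andP[t0 td] gt]; exists t%:C.
  by rewrite normc_real gtr0_norm // eq_complex /= eqxx andbT gt_eqF.
by rewrite hE gt mulr0.
Qed.

(** The values of [f] at its points [1] and [-1] force [Re g] to be nonnegative
    there, respectively nonpositive, and to dominate [|g|^2 / 2] in absolute
    value. As such points of both kinds accumulate at the origin, [Re g]
    vanishes on the real axis, and then so does [g] where [f] is [1]. *)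
Lemma entire_within_one_eq0 (f : R -> R[i]) (g : R[i] -> R[i]) : entire g ->
  (forall x, x != 0 -> normc (f x - g x%:C) <= 1) ->
  (forall d : R, 0 < d -> exists2 x, 0 < x < d & f x = 1) ->
  (forall d : R, 0 < d -> exists2 x, 0 < x < d & f x = -1) ->
  forall z, g z = 0.
Proof.
move=> eg fg f1 fN1.
have sq (a b : R) : normc (a +i* b) <= 1 -> a ^+ 2 + b ^+ 2 <= 1.
  move=> h; have s0 : 0 <= a ^+ 2 + b ^+ 2 by rewrite addr_ge0 // sqr_ge0.
  rewrite -(sqr_sqrtr s0) exprn_ile1 ?sqrtr_ge0 //.
have P1 x : x != 0 -> f x = 1 -> complex.Re (g x%:C) ^+ 2 +
    complex.Im (g x%:C) ^+ 2 <= 2 * complex.Re (g x%:C).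
  move=> x0 fx; have := fg x x0; rewrite fx; case: (g x%:C) => a b /=.
  rewrite -[1 - _]/((1 - a) +i* (0 - b)) => /sq.
  by rewrite sub0r sqrrN sqrrB expr1n mul1r -mulr_natl; lra.
have PN1 x : x != 0 -> f x = -1 -> complex.Re (g x%:C) ^+ 2 +
    complex.Im (g x%:C) ^+ 2 <= - 2 * complex.Re (g x%:C).
  move=> x0 fx; have := fg x x0; rewrite fx; case: (g x%:C) => a b /=.
  rewrite -[- 1 - _]/((-1 - a) +i* (- 0 - b)) => /sq.
  by rewrite oppr0 sub0r sqrrN; nra.
have cRe : continuous (fun t : R => complex.Re (g t%:C)).
  move=> t; apply: (@continuous_comp R C R (fun t => g t%:C) (@complex.Re R)).
    apply: (@continuous_comp R C C (real_complex R) g).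
      exact: continuous_real_complex.
    exact: entire_continuous.
  exact: continuous_Re.
have ReN x : x != 0 -> f x = 1 -> 0 <= complex.Re (g x%:C).
  move=> x0 fx; have := P1 _ x0 fx.
  have := sqr_ge0 (complex.Re (g x%:C)); have := sqr_ge0 (complex.Im (g x%:C)).
  lra.
have ReP x : x != 0 -> f x = -1 -> complex.Re (g x%:C) <= 0.
  move=> x0 fx; have := PN1 _ x0 fx.
  have := sqr_ge0 (complex.Re (g x%:C)); have := sqr_ge0 (complex.Im (g x%:C)).
  lra.
have Re0 : forall x : R, complex.Re (g x%:C) = 0.
  apply: Re_identity => // d d0.
  have [x /andP[x0 xd] /(ReN _ (lt0r_neq0 x0)) gx] := f1 d d0.
  have [y /andP[y0 yd] /(ReP _ (lt0r_neq0 y0)) gy] := fN1 d d0.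
  have [xy|yx] := leP x y.
    have [|c] := IVT xy (continuous_subspaceT cRe) (v := 0).
      by rewrite ge_min gy orbT le_max gx.
    rewrite in_itv /= => /andP[xc cy] gc; exists c => //.
    by rewrite (lt_le_trans x0 xc) (le_lt_trans cy yd).
  have [|c] := IVT (ltW yx) (continuous_subspaceT cRe) (v := 0).
    by rewrite ge_min gy le_max gx orbT.
  rewrite in_itv /= => /andP[yc cx] gc; exists c => //.
  by rewrite (lt_le_trans y0 yc) (le_lt_trans cx xd).
apply: identity_theorem => // d /f1[x /andP[x0 xd] fx]; exists x%:C.
  by rewrite normc_real gtr0_norm // eq_complex /= eqxx andbT gt_eqF.
have := P1 x (lt0r_neq0 x0) fx; rewrite Re0 expr0n /= add0r mulr0.
move=> b0; apply/eqP; rewrite eq_complex /= Re0 eqxx /=.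
by rewrite -sqrf_eq0 eq_le b0 sqr_ge0.
Qed.

End reflection.

(** * Best approximation *)

Section approximation.
Variable R : realType.
Local Notation C := (R[i]^o).

(** A set of full measure is dense, as balls have positive measure. *)
Lemma ae_le_continuous (h : R -> R) (e x : R) : {for x, continuous h} ->
  {ae @lebesgue_measure R, forall y, h y <= e} -> h x <= e.
Proof.
move=> ch [N [mN N0 hN]]; rewrite leNgt; apply/negP => ehx.
have d0 : 0 < h x - e by rewrite subr_gt0.
have /cvgrPdist_lt /(_ _ d0) /nbhs_ballP[d /= dpos Hd] := ch.
have bN : ball x d `<=` N.
  move=> y /Hd /= hy; apply: hN => /= hye.
  by have := ler_norm (h x - h y); lra.
have : (lebesgue_measure (ball x d) <= lebesgue_measure N)%E.
  by apply: le_measure => //; rewrite inE // ball_itv; exact: measurable_itv.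
rewrite (lebesgue_measure_ball _ (ltW dpos)) [X in (_ <= X)%E]N0 lee_fin.
by rewrite leNgt mulrn_wgt0.
Qed.

Lemma approx_error_le (f : R -> R[i]) (g : R[i] -> R[i]) (e x : R) :
  {for x, continuous (f : R -> C)} -> entire g ->
  (approx_error f g <= e%:E)%E -> normc (f x - g x%:C) <= e.
Proof.
move=> cf eg /ess_supP ae_le.
apply: (@ae_le_continuous (fun y => normc (f y - g y%:C))).
  apply: (@continuous_comp R C R (fun y => f y - g y%:C) (@normc R)).
    have cgx : {for x, continuous ((fun y => g y%:C) : R -> C)}.
      apply: (@continuous_comp R C C (real_complex R) g).
        exact: continuous_real_complex.
      exact: entire_continuous.
    by have D := @cvgB _ C _ _ _ _ _ _ _ cf cgx; exact: D.
  exact: continuous_normc.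
by apply: filterS ae_le => y; rewrite lee_fin.
Qed.

(** If [g] had an error below [1] then [g] would be [0], whose error is at least
    [1] because of a point where [f] is continuous with value [1]. *)
Lemma best_approximation_eq0 (sigma : R) (f : R -> R[i]) :
  (forall x, x != 0 -> {for x, continuous (f : R -> C)}) ->
  (forall x, normc (f x) <= 1) ->
  (forall d : R, 0 < d -> exists2 x, 0 < x < d & f x = 1) ->
  (forall d : R, 0 < d -> exists2 x, 0 < x < d & f x = -1) ->
  best_error sigma f = 1%:E /\
  forall g, exp_type sigma g ->
    approx_error f g = best_error sigma f <-> (forall z, g z = 0).
Proof.
move=> cf fle1 f1 fN1.
have e0 : exp_type sigma (fun _ : R[i] => 0).
  split=> [z|e _]; first exact: derivable_cst.
  by exists 0 => z; rewrite ComplexField.Normc.normc0 mul0r.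
have err_le1 g : (forall z, g z = 0) -> (approx_error f g <= 1%:E)%E.
  move=> g0; apply/ess_supP; apply: nearW => x.
  by rewrite g0 subr0 lee_fin.
have uniq g : entire g -> (approx_error f g <= 1%:E)%E -> forall z, g z = 0.
  move=> eg fg; apply: (entire_within_one_eq0 eg _ f1 fN1) => x x0.
  by apply: approx_error_le fg => //; exact: cf.
have err_ge1 g : entire g -> (1%:E <= approx_error f g)%E.
  move=> eg; rewrite leNgt; apply/negP => fg.
  have g0 := uniq g eg (ltW fg).
  have [e e1 fe] : exists2 e : R, e < 1 & (approx_error f g <= e%:E)%E.
    case: (approx_error f g) fg => [r|//|_].
      by rewrite lte_fin => r1; exists r.
    by exists 0 => //; rewrite leNye.
  have [x /andP[x0 _] fx] := f1 1 ltr01.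
  have := approx_error_le (cf x (lt0r_neq0 x0)) eg fe.
  by rewrite fx g0 subr0 ComplexField.Normc.normc1 leNgt e1.
have best1 : best_error sigma f = 1%:E.
  apply/eqP; rewrite eq_le; apply/andP; split.
    apply: ge_ereal_inf; exists (approx_error f (fun=> 0)); last exact: err_le1.
    by exists (fun=> 0).
  by apply: le_ereal_inf_tmp => _ [g [eg _] <-]; exact: err_ge1.
split=> // g [eg _]; rewrite best1; split=> [fg|g0].
  by apply: uniq => //; rewrite fg.
by apply/eqP; rewrite eq_le err_le1 // err_ge1.
Qed.

(** As [x] tends to [0] the phase [beta * ln x] runs off to plus or minus
    infinity, so it meets every class modulo [2 * pi] at points arbitrarily
    close to [0]. *)
Lemma oscillation (beta theta d : R) : beta != 0 -> 0 < d ->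
  exists2 x, 0 < x < d & f0c beta x = cos theta /\ f0s beta x = sin theta.
Proof.
move=> b0 d0; have pi0 := @pi_gt0 R.
have nb0 : 0 < `|beta| by rewrite normr_gt0.
pose n := (Num.trunc ((theta / beta - ln d) * `|beta| / (pi *+ 2))).+1.
pose y := theta / beta - n%:R * (pi *+ 2) / `|beta|.
have p0 : 0 < pi *+ 2 :> R by rewrite mulrn_wgt0.
have yd : y < ln d.
  have := truncnS_gt ((theta / beta - ln d) * `|beta| / (pi *+ 2)).
  by rewrite -/n ltr_pdivrMr // -ltr_pdivlMr // /y; lra.
exists (expR y).
  by rewrite expR_gt0 -ltr_ln ?posrE ?expR_gt0 // expRK.
rewrite /f0c /f0s gtr0_norm ?expR_gt0 // expRK.
have [bp|bn] : 0 < beta \/ beta < 0.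
  by move: b0; rewrite neq_lt => /orP[?|?]; [right|left].
  have -> : beta * y = theta - pi *+ 2 *+ n.
    by rewrite /y gtr0_norm // -[_ *+ n]mulr_natl; field; rewrite gt_eqF.
  rewrite -(periodicn (@cosD2pi R) n (theta - _)) subrK.
  by rewrite -(periodicn (@sinD2pi R) n (theta - _)) subrK.
have -> : beta * y = theta + pi *+ 2 *+ n.
  by rewrite /y ltr0_norm // -[_ *+ n]mulr_natl; field; rewrite lt_eqF.
by rewrite (periodicn (@cosD2pi R)) (periodicn (@sinD2pi R)).
Qed.

Lemma continuous_log_phase (beta x : R) : x != 0 ->
  {for x, continuous (fun y : R => beta * ln `|y|)}.
Proof.
move=> x0; apply: cvgM; first exact: cvg_cst.
apply: (@continuous_comp R R R (fun y => `|y|) (@ln R)).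
  exact: norm_continuous.
by apply: continuous_ln; rewrite normr_gt0.
Qed.

Lemma continuous_f0c (beta x : R) : x != 0 -> {for x, continuous (f0c beta)}.
Proof.
move=> x0; apply: (@continuous_comp R R R (fun y => beta * ln `|y|) (@cos R)).
  exact: continuous_log_phase.
exact: continuous_cos.
Qed.

Lemma continuous_f0s (beta x : R) : x != 0 -> {for x, continuous (f0s beta)}.
Proof.
move=> x0; apply: (@continuous_comp R R R (fun y => beta * ln `|y|) (@sin R)).
  exact: continuous_log_phase.
exact: continuous_sin.
Qed.

Lemma continuous_at_real_complex (h : R -> R) (x : R) :
  {for x, continuous h} -> {for x, continuous ((fun y => (h y)%:C) : R -> C)}.
Proof.
move=> ch; apply: (@continuous_comp R R C h (real_complex R)) => //.
exact: continuous_real_complex.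
Qed.

Lemma best_f0 (beta sigma : R) : beta != 0 ->
  best_error sigma (f0 beta) = 1%:E /\
  forall g, exp_type sigma g -> approx_error (f0 beta) g =
    best_error sigma (f0 beta) <-> (forall z, g z = 0).
Proof.
move=> b0; have E : f0 beta = fun x => (f0c beta x)%:C + 'i * (f0s beta x)%:C.
  by apply/funext => x; exact: f0E.
apply: best_approximation_eq0 => [x x0|x|d d0|d d0]; rewrite E.
- have cc := continuous_at_real_complex (continuous_f0c (beta := beta) x0).
  have cs := continuous_at_real_complex (continuous_f0s (beta := beta) x0).
  have ci : {for x, continuous ((fun=> 'i) : R -> C)} by exact: cvg_cst.
  have D1 := @cvgM R[i] _ _ _ _ _ _ _ ci cs.
  by apply: (@cvgD _ C); [exact: cc|exact: D1].
- rewrite /f0c /f0s; set u := beta * _.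
  have -> : (cos u)%:C + 'i * (sin u)%:C = cos u +i* sin u by simpc.
  by rewrite /ComplexField.Normc.normc cos2Dsin2 sqrtr1.
- have [x xd [c s]] := oscillation 0 b0 d0; exists x => //.
  by rewrite c s cos0 sin0 mulr0 addr0.
- have [x xd [c s]] := oscillation pi b0 d0; exists x => //.
  by rewrite c s cospi sinpi mulr0 addr0 rmorphN1.
Qed.

Lemma best_real (h : R -> R) (sigma : R) :
  (forall x, x != 0 -> {for x, continuous h}) -> (forall x, `|h x| <= 1) ->
  (forall d, 0 < d -> exists2 x, 0 < x < d & h x = 1) ->
  (forall d, 0 < d -> exists2 x, 0 < x < d & h x = -1) ->
  best_error sigma (fun x => (h x)%:C) = 1%:E /\
  forall g, exp_type sigma g -> approx_error (fun x => (h x)%:C) g =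
    best_error sigma (fun x => (h x)%:C) <-> (forall z, g z = 0).
Proof.
move=> ch h1 hp hn.
apply: best_approximation_eq0 => [x x0|x|d /hp[x xd hx]|d /hn[x xd hx]].
- exact/continuous_at_real_complex/ch.
- by rewrite normc_real.
- by exists x => //; rewrite hx.
- by exists x => //; rewrite hx rmorphN1.
Qed.

Lemma best_f0c (beta sigma : R) : beta != 0 ->
  best_error sigma (fun x => (f0c beta x)%:C) = 1%:E /\
  forall g, exp_type sigma g -> approx_error (fun x => (f0c beta x)%:C) g =
    best_error sigma (fun x => (f0c beta x)%:C) <-> (forall z, g z = 0).
Proof.
move=> b0; apply: best_real => [x|x|d d0|d d0].
- exact: continuous_f0c.
- by rewrite ler_norml cos_geN1 cos_le1.
- by have [x xd [c _]] := oscillation 0 b0 d0; exists x; rewrite // c cos0.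
- by have [x xd [c _]] := oscillation pi b0 d0; exists x; rewrite // c cospi.
Qed.

Lemma best_f0s (beta sigma : R) : beta != 0 ->
  best_error sigma (fun x => (f0s beta x)%:C) = 1%:E /\
  forall g, exp_type sigma g -> approx_error (fun x => (f0s beta x)%:C) g =
    best_error sigma (fun x => (f0s beta x)%:C) <-> (forall z, g z = 0).
Proof.
move=> b0; apply: best_real => [x|x|d d0|d d0].
- exact: continuous_f0s.
- by rewrite ler_norml sin_geN1 sin_le1.
- have [x xd [_ s]] := oscillation (pi / 2) b0 d0.
  by exists x; rewrite // s sin_pihalf.
- have [x xd [_ s]] := oscillation (- (pi / 2)) b0 d0.
  by exists x; rewrite // s sinN sin_pihalf.
Qed.

End approximation.

Theorem theorem1p5 (R : realType) (beta sigma : R)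
    (hbeta : beta != 0) (hsigma : 0 < sigma) :
  [/\ best_error sigma (f0 beta) = 1%:E,
      best_error sigma (fun x : R => (f0c beta x)%:C) = 1%:E &
      best_error sigma (fun x : R => (f0s beta x)%:C) = 1%:E] /\
  (forall f : R -> R[i],
     [\/ f = f0 beta,
         f = (fun x : R => (f0c beta x)%:C) |
         f = (fun x : R => (f0s beta x)%:C)] ->
     forall g : R[i] -> R[i], exp_type sigma g ->
       approx_error f g = best_error sigma f <-> (forall z : R[i], g z = 0)).
Proof.
have [c1 u1] := best_f0 sigma hbeta.
have [c2 u2] := best_f0c sigma hbeta.
have [c3 u3] := best_f0s sigma hbeta.
split; first by split; [exact: c1|exact: c2|exact: c3].
by move=> f [] ->; [exact: u1|exact: u2|exact: u3].
Qed.
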